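(* The 14 basis dimensions of $\mathcal{D} = \{A, T, P, C, B, D, S, Y, R, F, I, L, V, M\}$ are linearly independent over $\mathrm{GF}(2)$; that is, the 14 columns of the activation matrix $\mathcal{M}$ (one column per dimension) are linearly independent over $\mathrm{GF}(2)$, equivalently $\mathrm{rank}(\mathcal{M}) = 14$.
   Context: $\mathcal{D} = \{A, T, P, C, B, D, S, Y, R, F, I, L, V, M\}$ is a fixed set of 14 labels (''basis dimensions'' of the banking manifold), identified with the coordinates $1,\dots,14$. A corpus is a finite set of operations (API endpoints). For each operation $o$ in the corpus, the activation vector $v(o) \in \mathrm{GF}(2)^{14}$ has $v(o)_i = 1$ if and only if operation $o$ activates dimension $i$. The activation matrix $\mathcal{M}$ is the matrix over $\mathrm{GF}(2)$ whose rows are the vectors $v(o)$, one row per operation, with 14 columns. An operation $o$ is a pure signal for dimension $i$ if $v(o) = e_i$, the $i$-th standard basis vector. Standing (empirically observed) fact about the corpus: for every dimension $i \in \mathcal{D}$ the corpus contains at least one pure signal for $i$. *)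

(* Defs.v *)
From HB Require Import structures.
From mathcomp Require Import all_boot all_order all_algebra.

Set Implicit Arguments.
Unset Strict Implicit.
Unset Printing Implicit Defensive.

Import GRing.Theory.
Local Open Scope ring_scope.

Inductive dimension : Type :=
  | dim_A | dim_T | dim_P | dim_C | dim_B | dim_D | dim_S
  | dim_Y | dim_R | dim_F | dim_I | dim_L | dim_V | dim_M.

Definition labels : 14.-tuple dimension :=
  [tuple dim_A; dim_T; dim_P; dim_C; dim_B; dim_D; dim_S;
         dim_Y; dim_R; dim_F; dim_I; dim_L; dim_V; dim_M].

(* The coordinates 1, ..., 14 are the elements 0, ..., 13 of 'I_14. *)
Definition label (j : 'I_14) : dimension := tnth labels j.

Definition coord_of (d : dimension) : 'I_14 :=
  inord (match d with
         | dim_A => 0 | dim_T => 1 | dim_P => 2 | dim_C => 3 | dim_B => 4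
         | dim_D => 5 | dim_S => 6 | dim_Y => 7 | dim_R => 8 | dim_F => 9
         | dim_I => 10 | dim_L => 11 | dim_V => 12 | dim_M => 13
         end)%N.

Lemma coord_ofK : cancel coord_of label.
Proof. by case; rewrite /label (tnth_nth dim_A) inordK. Qed.

Lemma labelK : cancel label coord_of.
Proof.
move=> j; apply: val_inj; rewrite /label (tnth_nth dim_A).
by case: j => m lt_m; do 14?[case: m lt_m => [|m] lt_m;
  first by rewrite /= inordK].
Qed.

(* The finite type [corpus] is the set of operations; [activates o d] says
   that the operation [o] activates the dimension [d]. *)
Definition activation_vector (corpus : finType)
    (activates : corpus -> dimension -> bool) (o : corpus) : 'rV['F_2]_14 :=
  \row_(j < 14) (activates o (label j))%:R.

Definition activation_matrix (corpus : finType)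
    (activates : corpus -> dimension -> bool) : 'M['F_2]_(#|corpus|, 14) :=
  \matrix_(i < #|corpus|) activation_vector activates (enum_val i).

Definition pure_signal (corpus : finType)
    (activates : corpus -> dimension -> bool) (o : corpus) (d : dimension) :
    Prop :=
  activation_vector activates o = delta_mx 0 (coord_of d).

(* Main.v *)
Require Import Defs.
From mathcomp Require Import all_boot all_order all_algebra.

(** A pure signal for the dimension of coordinate [j] makes the unit vector
    [e_j] a row of the activation matrix.  Since every dimension has a pure
    signal, the row space contains the whole standard basis, so it is all of
    GF(2)^14 and the rank is 14 ([row_full_unit_rows]).  A matrix of full
    column rank is left invertible, and multiplying a vanishing combination of
    its columns by a left inverse kills every coefficient
    ([row_full_free_cols]). *)

Import GRing.Theory.
Local Open Scope ring_scope.

Lemma row_full_unit_rows (F : fieldType) (m n : nat) (A : 'M[F]_(m, n)) :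
  (forall j, exists i, row i A = delta_mx 0 j) -> row_full A.
Proof.
move=> unit_rows; rewrite -sub1mx; apply/row_subP => j; rewrite row1.
by have [i <-] := unit_rows j; apply: row_sub.
Qed.

(** The combination of the columns with coefficients [k] is the product of
    [A] with the column vector [k], so a left inverse of [A] recovers [k]. *)
Lemma row_full_free_cols (F : fieldType) (m n : nat) (A : 'M[F]_(m, n)) :
  row_full A -> free [tuple col j A | j < n].
Proof.
case/row_fullP => B BA1; apply/freeP => k comb0 j.
have Ak0 : A *m (\col_j k j) = 0.
  rewrite -[RHS]comb0; apply/matrixP => i z; rewrite mxE summxE.
  apply: eq_bigr => l _.
  by rewrite (nth_map l) ?size_enum_ord // nth_ord_enum !mxE mulrC.
have k0 : \col_j k j = 0 by rewrite -[LHS]mul1mx -BA1 -mulmxA Ak0 mulmx0.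
by move/matrixP/(_ j 0): k0; rewrite !mxE.
Qed.

Theorem theorem4p4 (corpus : finType)
    (activates : corpus -> dimension -> bool)
    (pure_signals : forall d : dimension,
        exists o : corpus, pure_signal activates o d) :
  free [tuple col j (activation_matrix activates) | j < 14] /\
  \rank (activation_matrix activates) = 14%N.
Proof.
have full : row_full (activation_matrix activates).
  apply: row_full_unit_rows => j.
  have [o pure_o] := pure_signals (label j); exists (enum_rank o).
  by rewrite rowK enum_rankK pure_o labelK.
by split; [apply: row_full_free_cols | apply/eqP].
Qed.
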